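(* Let $V\simeq\mathbb{C}^3$ and $\lambda=(4,2)$, so that $F_{(4,2),3}\simeq\mathrm{Fl}(1,2;V)\subseteq\mathbb{P}(\mathbb{S}_{(4,2)}V)$ is the embedding induced by $\mathcal{O}(2,2)$. Let $S$ be the semistandard tableau of shape $(4,2)$ with first row $1,1,2,2$ and second row $2,2$ (i.e. its columns are, from left to right, $\{1,2\},\{1,2\},\{2\},\{2\}$), and let $\mathbf{x}_S\in\mathbb{S}_{(4,2)}V^*$ be the associated basis element. Then $$\mathbf{x}_S\in\left(\widehat T_{P_{(4,2),3}}F_{(4,2),3}\right)^\perp\setminus\left(I_{\mathrm S}(P_{(4,2),3})^2\right)_{(4,2)}.$$ Therefore $$\left(\widehat T_{P_{(4,2),3}}F_{(4,2),3}\right)^\perp\neq\left(I_{\mathrm S}(P_{(4,2),3})^2\right)_{(4,2)}.$$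
   Context: $V$ is a complex vector space of dimension $n$ (here $n=3$) with basis $e_1,\dots,e_n$ and dual basis $x_1,\dots,x_n$; $G=\mathrm{GL}(V)$. For a partition $\alpha$ with $\ell(\alpha)\le n$, $\mathbb{S}_\alpha V$ is the irreducible polynomial $G$-module of highest weight $\alpha$ and $\mathbb{S}_\alpha V^*$ is its dual; $\alpha'$ is the conjugate partition. Flag variety. For $\ell(\lambda)<n$, $\mathbf{v}_{\lambda,n}\in\mathbb{S}_\lambda V$ is a highest-weight vector (for the standard Borel subgroup of upper triangular matrices), $P_{\lambda,n}=[\mathbf{v}_{\lambda,n}]\in\mathbb{P}(\mathbb{S}_\lambda V)$ and $F_{\lambda,n}=G\cdot P_{\lambda,n}$ is the closed orbit. $\widehat T_PF_{\lambda,n}\subseteq\mathbb{S}_\lambda V$ is the affine tangent space, i.e. the Zariski tangent space to the affine cone over $F_{\lambda,n}$ at a nonzero representative of $P$, and $\perp$ denotes the annihilator in $\mathbb{S}_\lambda V^*$ with respect to the duality pairing. Basis element. For $\lambda=(4,2)$ there is, up to scalar, a unique nonzero $G$-equivariant surjection $\pi_\lambda:\mathrm{Sym}^2(V^* )\otimes\mathrm{Sym}^2(\bigwedge^2V^* )\to\mathbb{S}_{(4,2)}V^*$ (dual to the inclusion of the Cartan component); one fixes it. For the semistandard tableau $S$ of shape $(4,2)$ with first row $1,1,2,2$ and second row $2,2$ (columns, from left to right, $\{1,2\},\{1,2\},\{2\},\{2\}$), the associated basis element is $\mathbf{x}_S=\pi_\lambda\big(x_2^2\otimes(x_1\wedge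 x_2)^2\big)$. Dual Schur algebra. $\mathbb{S}^\bullet V^*=\bigoplus_{\ell(\alpha)\le n}\mathbb{S}_\alpha V^*$, with product $\diamond$ defined bilinearly by $\varphi\diamond\psi=\sum_\gamma\mathcal{M}^{\alpha,\beta}_\gamma(\varphi\otimes\psi)$ for $\varphi\in\mathbb{S}_\alpha V^*$, $\psi\in\mathbb{S}_\beta V^*$, where $\mathcal{M}^{\alpha,\beta}_\gamma:\mathbb{S}_\alpha V^*\otimes\mathbb{S}_\beta V^*\to\mathbb{S}_\gamma V^*$ is the fixed coherent family of $G$-equivariant linear maps chosen by Staffolani (''Schur apolarity'', J. Symbolic Comput. 114 (2023)); such a map can be nonzero only if the Littlewood–Richardson coefficient $c^\gamma_{\alpha,\beta}$ is nonzero. For a subspace $A\subseteq\mathbb{S}^\bullet V^*$, $(A)_\alpha=A\cap\mathbb{S}_\alpha V^*$. Schur apolarity action. Realize $\mathbb{S}_\alpha V$ (resp. $\mathbb{S}_\alpha V^*$) as the unique $G$-submodule of that isomorphism type in $\bigotimes_{c}\bigwedge^{\alpha'_c}V$ (resp. $\bigotimes_c\bigwedge^{\alpha'_c}V^*$), the column realization. For $\mu\subseteq\lambda$ (put $\mu'_c=0$ for $c>\mu_1$), the action $*:\mathbb{S}_\mu V^*\otimes\mathbb{S}_\lambda V\to\mathbb{S}_{\lambda/\mu}V\subseteq\bigotimes_{c=1}^{\lambda_1}\bigwedge^{\lambda'_c-\mu'_c}V$ is the restriction of the tensor product over $c$ of the usual skew-symmetric contractions $\bigwedge^{\mu'_c}V^*\otimes\bigwedge^{\lambda'_c}V\to\bigwedge^{\lambda'_c-\mu'_c}V$;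 here $\mathbb{S}_{\lambda/\mu}V$ is the skew Schur module. If $\mu\not\subseteq\lambda$ the action is zero. It is extended to $\mathbb{S}^\bullet V^*\otimes\mathbb{S}_\lambda V\to\bigoplus_{\mu\subseteq\lambda}\mathbb{S}_{\lambda/\mu}V$ componentwise. For $P=[p]$, the Schur apolar ideal is $I_{\mathrm S}(P)=\{\varphi\in\mathbb{S}^\bullet V^*\mid\varphi*p=0\}$, and $I_{\mathrm S}(P)^2$ is its algebraic square, i.e. the span of all products $\varphi\diamond\psi$ with $\varphi,\psi\in I_{\mathrm S}(P)$. *)

(* Defs.v *)
From HB Require Import structures.
From mathcomp Require Import all_boot all_order all_algebra perm.
From mathcomp Require classical_sets.
From mathcomp Require Import fsbigop reals complex mpoly.

Set Implicit Arguments.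
Unset Strict Implicit.
Unset Printing Implicit Defensive.

Import GRing.Theory.
Local Open Scope ring_scope.

(* V = F^n with basis e_i, dual basis x_i, indices i : 'I_n starting at 0.    *)

Section LinearNotions.
Variables (F : fieldType) (W W' W'' : lmodType F).

Definition in_span (P : W -> Prop) (w : W) : Prop :=
  exists k (a : 'I_k -> F) (v : 'I_k -> W),
    (forall i, P (v i)) /\ w = \sum_(i < k) a i *: v i.

Definition linear_on (P : W -> Prop) (f : W -> W') : Prop :=
  forall a u v, P u -> P v -> f (a *: u + v) = a *: f u + f v.

Definition bilinear_on (P : W -> Prop) (Q : W' -> Prop) (f : W -> W' -> W'') :=
  (forall v, Q v -> forall a u u', P u -> P u' ->
     f (a *: u + u') v = a *: f u v + f u' v) /\
  (forall u, P u -> forall a v v', Q v -> Q v' ->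
     f u (a *: v + v') = a *: f u v + f u v').

End LinearNotions.

Section Exterior.
Variables (F : fieldType) (n : nat).

(* The exterior algebra of F^n: u : ext stands for \sum_A u A *: e_A, where   *)
(* e_A is the wedge of the e_i, i in A, in increasing order.                  *)
Definition ext := {ffun {set 'I_n} -> F^o}.

(* e_A /\ e_B = shuffle_sign A B *: e_(A :|: B) for disjoint A, B.            *)
Definition shuffle_sign (A B : {set 'I_n}) : F :=
  (-1) ^+ #|[set ij in setX A B | (ij.2 < ij.1)%N]|.

Definition wedge (u v : ext) : ext :=
  [ffun C : {set 'I_n} => \sum_(A : {set 'I_n} | A \subset C)
     shuffle_sign A (C :\: A) * u A * v (C :\: A)].

Definition ext1 : ext := [ffun A : {set 'I_n} => (A == set0)%:R].

Definition ext_vec (v : 'cV[F]_n) : ext :=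
  [ffun A : {set 'I_n} => \sum_i v i 0 * (A == [set i])%:R].

(* g e_B = g e_(b_1) /\ ... /\ g e_(b_k) for B = {b_1 < ... < b_k}            *)
Definition ext_act_basis (g : 'M[F]_n) (B : {set 'I_n}) : ext :=
  \big[wedge/ext1]_(b <- enum B) ext_vec (col b g).

(* The m-th tensor power of ext, a tensor being given by its coordinates on   *)
(* the basis e_(A 0) (x) ... (x) e_(A (m - 1)).                               *)
Definition coltens (m : nat) := {ffun {ffun 'I_m -> {set 'I_n}} -> F^o}.

Definition basis_tens m (B : {ffun 'I_m -> {set 'I_n}}) : coltens m :=
  [ffun A : {ffun 'I_m -> {set 'I_n}} => (A == B)%:R].

Definition act m (g : 'M[F]_n) (t : coltens m) : coltens m :=
  [ffun A : {ffun 'I_m -> {set 'I_n}} =>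
     \sum_B t B * \prod_c ext_act_basis g (B c) (A c)].

(* Action of g on tensors over V^*, in coordinates on the x_A: on V^* the     *)
(* matrix of g in the basis x is the inverse transpose of g.                  *)
Definition dual_act m (g : 'M[F]_n) (t : coltens m) : coltens m :=
  act (invmx g)^T t.

(* The duality pairing, with <x_A, e_B> = 1 if A = B and 0 otherwise.         *)
Definition pairing m (phi t : coltens m) : F := \sum_A phi A * t A.

End Exterior.

(* Partitions with at most n parts, padded with zeros to length n.            *)
Definition parts (n : nat) := {a : n.-tuple nat | sorted geq a}.

Section SchurModules.
Variables (F : fieldType) (n : nat).
Implicit Types (alpha beta gamma lambda mu : parts n).

Definition part_row alpha (i : 'I_n) : nat := tnth (val alpha) i.

Definition part_sub mu lambda : bool :=
  [forall i, (part_row mu i <= part_row lambda i)%N].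

(* alpha_1, the number of columns *)
Definition width alpha : nat := nth 0%N (val alpha) 0.

(* Length of column c (counted from 0), i.e. alpha'_(c+1).                    *)
Definition col_height alpha (c : nat) : nat :=
  count (fun r => (c < r)%N) (val alpha).

(* Tensors lying in the tensor product over c of the alpha'_c-th exterior     *)
(* powers                                                                     *)
Definition in_columns alpha (t : coltens F n (width alpha)) : Prop :=
  forall A, t A != 0 -> forall c, #|A c| = col_height alpha c.
Arguments in_columns : clear implicits.

Definition hw_tens alpha : coltens F n (width alpha) :=
  basis_tens F
    [ffun c : 'I_(width alpha) => [set i : 'I_n | (i < col_height alpha c)%N]].

(* Column realizations of S_alpha V and S_alpha V^*: the copy of the          *)
(* irreducible module inside the tensor product of exterior powers is the one *)
(* generated by the tensor of the e_1 /\ ... /\ e_(alpha'_c), respectively of *)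
(* the x_1 /\ ... /\ x_(alpha'_c); its weight is extremal and has             *)
(* multiplicity one in the tensor product.                                    *)
Definition schur alpha : coltens F n (width alpha) -> Prop :=
  in_span (fun t => exists2 g, g \in unitmx & t = act g (hw_tens alpha)).
Arguments schur : clear implicits.

Definition schur_dual alpha : coltens F n (width alpha) -> Prop :=
  in_span (fun t => exists2 g, g \in unitmx & t = dual_act g (hw_tens alpha)).
Arguments schur_dual : clear implicits.

Definition highest_weight_vector lambda (v : coltens F n (width lambda)) :=
  [/\ schur lambda v, v != 0 &
      forall b : 'M[F]_n, b \in unitmx ->
        (forall i j : 'I_n, (j < i)%N -> b i j = 0) ->
        act b v = (\prod_i b i i ^+ part_row lambda i) *: v].
Arguments highest_weight_vector : clear implicits.

(* The affine cone over the orbit of [v] in the projective space of S_lambda V *)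
Definition orbit_cone m (v x : coltens F n m) : Prop :=
  exists (a : F) (g : 'M[F]_n), g \in unitmx /\ x = a *: act g v.

Definition coords m (t : coltens F n m) :
    'I_#|{ffun 'I_m -> {set 'I_n}}| -> F :=
  fun i => t (enum_val i).

(* Zariski tangent space at p: the common zeros of the differentials at p of  *)
(* the polynomials vanishing on X. For X inside S_lambda V it lies in         *)
(* S_lambda V, whose linear equations are among these polynomials.            *)
Definition zariski_tangent m (X : coltens F n m -> Prop)
    (p w : coltens F n m) : Prop :=
  forall f : {mpoly F[#|{ffun 'I_m -> {set 'I_n}}|]},
    (forall x, X x -> f.@[coords x] = 0) ->
    \sum_i (f^`M(i)).@[coords p] * coords w i = 0.

Definition affine_tangent m (p : coltens F n m) : coltens F n m -> Prop :=
  zariski_tangent (orbit_cone p) p.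

Definition annihilator lambda (T : coltens F n (width lambda) -> Prop)
    (phi : coltens F n (width lambda)) : Prop :=
  schur_dual lambda phi /\ forall w, T w -> pairing phi w = 0.
Arguments annihilator : clear implicits.

(* The tensor product over k of Sym^(m_k) of the k-th exterior power of V^*,  *)
(* m_k being the number of columns of length k, realized as the tensors       *)
(* symmetric under permutations of columns of equal length. Here              *)
(* u ^ m in Sym^m is u (x) ... (x) u.                                         *)
Definition sym_columns alpha (t : coltens F n (width alpha)) : Prop :=
  in_columns alpha t /\
  forall s : {perm 'I_(width alpha)},
    (forall c, col_height alpha (s c) = col_height alpha c) ->
    forall A : {ffun 'I_(width alpha) -> {set 'I_n}},
      t [ffun c => A (s c)] = t A.
Arguments sym_columns : clear implicits.

Definition cartan_projection alpha
    (pi : coltens F n (width alpha) -> coltens F n (width alpha)) : Prop :=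
  [/\ linear_on (sym_columns alpha) pi,
      forall t, sym_columns alpha t -> schur_dual alpha (pi t),
      forall g t, g \in unitmx -> sym_columns alpha t ->
        pi (dual_act g t) = dual_act g (pi t) &
      forall phi, schur_dual alpha phi -> exists2 t, sym_columns alpha t & pi t = phi].
Arguments cartan_projection : clear implicits.

Section DualSchurAlgebra.

Definition graded := forall alpha, coltens F n (width alpha).

Definition schur_alg (phi : graded) : Prop :=
  (forall alpha, schur_dual alpha (phi alpha)) /\
  exists s : seq (parts n), forall alpha, alpha \notin s -> phi alpha = 0.

(* The structure maps of the product, as bilinear maps on                     *)
(* S_alpha V^* x S_beta V^*.                                                  *)
Definition structure_maps := forall alpha beta gamma,
  coltens F n (width alpha) -> coltens F n (width beta) ->
  coltens F n (width gamma).

(* Equivariance forces M alpha beta gamma = 0 whenever the                    *)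
(* Littlewood-Richardson coefficient c^gamma_(alpha,beta) is 0.               *)
Definition equivariant_maps (M : structure_maps) : Prop :=
  forall alpha beta gamma,
  [/\ bilinear_on (schur_dual alpha) (schur_dual beta) (M alpha beta gamma),
      forall phi psi, schur_dual alpha phi -> schur_dual beta psi ->
        schur_dual gamma (M alpha beta gamma phi psi) &
      forall g phi psi, g \in unitmx -> schur_dual alpha phi -> schur_dual beta psi ->
        M alpha beta gamma (dual_act g phi) (dual_act g psi) =
        dual_act g (M alpha beta gamma phi psi)].

(* phi and psi have finitely many nonzero components, so the sum has finite   *)
(* support.                                                                   *)
Definition diamond (M : structure_maps) (phi psi : graded) : graded :=
  fun gamma => \sum_(ab \in @classical_sets.setT (parts n * parts n)%type)
    M ab.1 ab.2 gamma (phi ab.1) (psi ab.2).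

End DualSchurAlgebra.

Section Apolarity.

(* Column c of a tuple of columns, empty if there is no such column.          *)
Definition column m (A : {ffun 'I_m -> {set 'I_n}}) (c : nat) : {set 'I_n} :=
  oapp A set0 (insub c).

(* Tensor product over the columns of lambda of the contractions that send    *)
(* x_A (x) (e_A /\ e_D) to e_D, for A, D disjoint, and x_A (x) e_B to 0 if A  *)
(* is not contained in B.                                                     *)
Definition contract mu lambda (phi : coltens F n (width mu))
    (t : coltens F n (width lambda)) : coltens F n (width lambda) :=
  if part_sub mu lambda then
    [ffun D : {ffun 'I_(width lambda) -> {set 'I_n}} =>
       \sum_(A | [forall c, [disjoint column A (val c) & D c]])
          phi A * (\prod_c shuffle_sign F (column A (val c)) (D c))
          * t [ffun c => column A (val c) :|: D c]]
  else 0.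
Arguments contract : clear implicits.

(* The components lie in distinct summands S_(lambda/mu) V, hence vanish      *)
(* separately.                                                                *)
Definition apolar_ideal lambda (p : coltens F n (width lambda))
    (phi : graded) : Prop :=
  schur_alg phi /\ forall mu, contract mu lambda (phi mu) p = 0.
Arguments apolar_ideal : clear implicits.

Definition ideal_square (M : structure_maps) (I : graded -> Prop)
    (z : graded) : Prop :=
  exists k (a : 'I_k -> F) (phi psi : 'I_k -> graded),
    (forall i, I (phi i) /\ I (psi i)) /\
    forall gamma, z gamma = \sum_(i < k) a i *: diamond M (phi i) (psi i) gamma.

(* The intersection of A with the summand S_alpha V^*, as a subset of that    *)
(* summand.                                                                   *)
Definition component (A : graded -> Prop) alpha
    (phi : coltens F n (width alpha)) : Prop :=
  schur_dual alpha phi /\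
  exists z, [/\ A z, z alpha = phi &
                forall gamma, gamma != alpha -> z gamma = 0].
Arguments component : clear implicits.

End Apolarity.
End SchurModules.

Arguments in_columns {F n} alpha t.
Arguments schur {F n} alpha _.
Arguments schur_dual {F n} alpha _.
Arguments highest_weight_vector {F n} lambda v.
Arguments annihilator {F n} lambda T phi.
Arguments sym_columns {F n} alpha t.
Arguments cartan_projection {F n} alpha pi.
Arguments contract {F n} mu lambda phi t.
Arguments apolar_ideal {F n} lambda p phi.
Arguments component {F n} A alpha phi.

Definition part42 : parts 3 := exist _ [tuple 4; 2; 0] isT.

(* The tableau with rows 1 1 2 2 and 2 2, read by columns; the labels 1 and 2 *)
(* are the elements 0 and 1 of 'I_3.                                          *)
Definition tableauS : {ffun 'I_(width part42) -> {set 'I_3}} :=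
  [ffun c : 'I_(width part42) =>
     nth set0 [:: [set 0; 1]; [set 0; 1]; [set 1]; [set 1]] c].

(* pi (x_2 ^ 2 (x) (x_1 /\ x_2) ^ 2), the columns of length two coming first. *)
Definition xS (F : fieldType)
    (pi : coltens F 3 (width part42) -> coltens F 3 (width part42)) :=
  pi (basis_tens F tableauS).

(* Main.v *)
Require Import Defs.
From mathcomp Require Import all_boot all_order all_algebra.
From mathcomp Require Import perm reals complex zify ring mpoly.

(* The vector x_S is a multiple of the basis tensor of the tableau S, of      *)
(* extremal weight (2, 4, 0). On the cone over the flag variety, the          *)
(* coordinates at columns (12, 12, i, j) are proportional to g_i * g_j; the   *)
(* conic relation among them has differential at p a nonzero multiple of the  *)
(* coordinate at S, so x_S annihilates the tangent space.                     *)
(* If a product of two weight vectors of the ideal has a nonzero coordinate   *)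
(* at S, their weights add up to (2, 4, 0), hence one of them is bounded by   *)
(* (2, 2, 0). But any tuple of columns of such a weight can be moved, by      *)
(* permuting columns of length one, inside the columns of                     *)
(* p = (e_1 /\ e_2) ^ 2 (x) e_1 ^ 2, so a form of this weight that contracts  *)
(* p to 0 vanishes.                                                           *)

Set Implicit Arguments.
Unset Strict Implicit.
Unset Printing Implicit Defensive.

Import GRing.Theory Num.Theory.
Local Open Scope ring_scope.

(** One linear form separates the two spaces: the coordinate at [tableauS]. Since (2, 4, 0) is an
    extremal weight, its weight space in the tensor product of exterior powers is the line spanned
    by the basis tensor of [tableauS] ([columns42_uniq]); equivariance and surjectivity of [pi] make
    [xS pi] a nonzero point of this line ([xS_tens]). It remains to see that the coordinate at
    [tableauS] vanishes on the tangent space, by the conic relation ([affine_tangent_tableauS]), and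
    on the degree (4, 2) component of the squared ideal ([ideal_square_tableauS]).

    For the square, no formula for the structure maps is available, only equivariance. The factors
    are therefore cut into eigenvectors of the torus element diag(2, 3, 5), whose eigenvalues
    determine weights; eigenvalues multiply, so weights add ([apolar_product]). The coordinates of
    an apolar form at weights bounded by (2, 2, 0) all vanish ([low_weight_apolar]), which excludes
    every splitting of (2, 4, 0). *)

Section Subspaces.
Variables (F : fieldType) (W W' : lmodType F).
Implicit Types (P : W -> Prop) (f : W -> W').

(** * Subspaces as predicates, and maps linear on them *)

Definition subspace P :=
  P 0 /\ forall a u v, P u -> P v -> P (a *: u + v).

Lemma subspaceZ P a u : subspace P -> P u -> P (a *: u).
Proof. by move=> [P0 PD] Pu; rewrite -[_ *: _]addr0; exact: PD. Qed.

Lemma subspaceD P u v : subspace P -> P u -> P v -> P (u + v).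
Proof. by move=> [P0 PD] Pu Pv; rewrite -[u]scale1r; exact: PD. Qed.

Lemma subspace_sum P I (r : seq I) (u : I -> W) :
  subspace P -> (forall i, P (u i)) -> P (\sum_(i <- r) u i).
Proof.
move=> sP Pu; apply: big_ind => // [|x y]; first by case: sP.
exact: subspaceD.
Qed.

Lemma in_span_min P Q w :
  subspace Q -> (forall v, P v -> Q v) -> in_span P w -> Q w.
Proof.
move=> sQ PQ [k [a [v [Pv ->]]]]; apply: subspace_sum => // i.
by apply: subspaceZ => //; exact: PQ.
Qed.

Lemma in_span_gen P w : P w -> in_span P w.
Proof.
by move=> Pw; exists 1%N, (fun=> 1), (fun=> w); rewrite big_ord1 scale1r.
Qed.

Lemma in_span_subspace P : subspace (in_span P).
Proof.
split=> [|a _ _ [k [b [u [Pu ->]]]] [l [c [v [Pv ->]]]]].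
  have w0 : forall i : 'I_0, W by case.
  by exists 0%N, (fun=> 0), w0; split; [case | rewrite big_ord0].
exists (k + l)%N.
exists (fun i => match split i with inl j => a * b j | inr j => c j end).
exists (fun i => match split i with inl j => u j | inr j => v j end).
split=> [i|]; first by case: split.
rewrite big_split_ord /= scaler_sumr; congr (_ + _); apply: eq_bigr => i _.
  by rewrite (unsplitK (inl i)) scalerA.
by rewrite (unsplitK (inr i)).
Qed.

Lemma linear_on0 P f : subspace P -> linear_on P f -> f 0 = 0.
Proof.
move=> [P0 _] fP; have := fP 1 0 0 P0 P0.
by rewrite !scale1r addr0 => /eqP; rewrite -subr_eq0 opprD addNKr oppr_eq0 => /eqP.
Qed.

Lemma linear_onZ P f a u : subspace P -> linear_on P f -> P u -> f (a *: u) = a *: f u.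
Proof.
move=> sP fP Pu; rewrite -[a *: u]addr0 fP ?(linear_on0 sP fP) ?addr0 //.
by case: sP.
Qed.

Lemma linear_on_sum P f I (r : seq I) (u : I -> W) :
  subspace P -> linear_on P f -> (forall i, P (u i)) ->
  f (\sum_(i <- r) u i) = \sum_(i <- r) f (u i).
Proof.
move=> sP fP Pu; elim: r => [|i r IHr].
  by rewrite !big_nil (linear_on0 sP fP).
rewrite !big_cons -[u i]scale1r fP ?IHr ?scale1r //.
exact: subspace_sum.
Qed.

End Subspaces.

(** * Minors of diagonal and monomial matrices: the action on exterior powers *)

Section Exterior.
Variables (F : fieldType) (n : nat).
Implicit Types (u v : ext F n) (A B C : {set 'I_n}) (g : 'M[F]_n).

Lemma ext_vecE (x : 'cV[F]_n) A :
  ext_vec x A = \sum_i x i 0 * (A == [set i])%:R.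
Proof. by rewrite ffunE. Qed.

Lemma big_wedge_card (s : seq 'I_n) g C :
  (\big[@wedge F n/ext1 F n]_(b <- s) ext_vec (col b g)) C != 0 ->
  #|C| = size s.
Proof.
elim: s C => [|b s IHs] C.
  by rewrite big_nil ffunE; case: (C =P set0) => [->|_]; rewrite ?cards0 ?eqxx.
rewrite big_cons ffunE => /negP nz.
case: (boolP [exists A : {set 'I_n}, (A \subset C) &&
   (ext_vec (col b g) A != 0) &&
   ((\big[@wedge F n/ext1 F n]_(b <- s) ext_vec (col b g)) (C :\: A) != 0)]).
  case/existsP=> A /andP[/andP[sAC uA] /IHs sC].
  have cA : #|A| = 1%N.
    apply/eqP; apply: contraNT uA => A1; rewrite ext_vecE big1 // => i _.
    by case: eqP => [E|]; rewrite ?mulr0 // E cards1 eqxx in A1 *.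
  by rewrite -(cardsID A C) sC (setIidPr sAC) cA add1n.
rewrite negb_exists => /forallP all0; case: nz; apply/eqP.
apply: big1 => A sAC; have := all0 A; rewrite sAC /= negb_and !negbK.
by case/orP=> /eqP ->; rewrite ?mulr0 ?mul0r.
Qed.

Lemma ext_act_basis_card g B C : ext_act_basis g B C != 0 -> #|C| = #|B|.
Proof. by move/big_wedge_card ->; rewrite cardE. Qed.

(** A coordinate of a wedge of columns of a matrix is a minor, and a diagonal left factor scales the
    rows that enter it. *)
Lemma ext_act_basis_diag (d : 'I_n -> F) g B C :
  ext_act_basis (diag_mx (\row_i d i) *m g) B C
  = (\prod_(i in C) d i) * ext_act_basis g B C.
Proof.
rewrite /ext_act_basis; elim: (enum B) C => [|b s IHs] C.
  rewrite !big_nil !ffunE; case: eqP => [->|_]; last by rewrite !mulr0.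
  by rewrite big_set0 mul1r.
rewrite !big_cons !ffunE mulr_sumr; apply: eq_bigr => A sAC; rewrite IHs.
have -> : ext_vec (col b (diag_mx (\row_i d i) *m g)) A =
    (\prod_(i in A) d i) * ext_vec (col b g) A.
  rewrite !ext_vecE mulr_sumr; apply: eq_bigr => i _.
  rewrite mul_diag_mx !mxE; case: eqP => [->|_]; last by rewrite !mulr0.
  by rewrite big_set1 !mulr1.
rewrite [\prod_(i in C) _](big_setID A) /= (setIidPr sAC); ring.
Qed.

Lemma wedge_ext_vec i a u C :
  wedge (ext_vec (a *: delta_mx i 0)) u C =
  if i \in C then a * shuffle_sign F [set i] (C :\ i) * u (C :\ i) else 0.
Proof.
have vE A : ext_vec (a *: delta_mx i 0) A = a * (A == [set i])%:R.
  rewrite ext_vecE (bigD1 i) //= !mxE !eqxx mulr1 big1 ?addr0 // => j ji.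
  by rewrite !mxE (negPf ji) mulr0 mul0r.
rewrite ffunE; case: ifP => iC.
  rewrite (bigD1 [set i]) ?sub1set //= vE eqxx mulr1 big1 ?addr0.
    by rewrite [_ * a]mulrC.
  by move=> A /andP[_ Ai]; rewrite vE (negPf Ai) !mulr0 mul0r.
rewrite big1 // => A sAC; rewrite vE; case: eqP => [E|]; last by rewrite !mulr0 mul0r.
by rewrite E sub1set iC in sAC.
Qed.

(** Injectivity of [f] keeps the wedge factors distinct, so only a sign and nonzero scalars
    appear. *)
Lemma ext_act_basis_mono g (d : 'I_n -> F) (f : 'I_n -> 'I_n) B :
  injective f -> (forall b, d b != 0) ->
  (forall b, col b g = d b *: delta_mx (f b) 0) ->
  ext_act_basis g B (f @: B) != 0.
Proof.
move=> f_inj d0 gE; rewrite /ext_act_basis.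
have -> : f @: B = [set f b | b in enum B] 
  by apply/setP=> x; apply/imsetP/imsetP => -[b Bb ->]; exists b => //;
    rewrite mem_enum in Bb *.
elim: (enum B) (enum_uniq B) => [|b s IHs] /= => [_|/andP[bs us]].
  rewrite big_nil ffunE.
  have -> : [set f b | b in [::]] = set0.
    by apply/setP=> x; rewrite inE; apply/imsetP => -[].
  by rewrite eqxx oner_eq0.
rewrite big_cons gE wedge_ext_vec.
have -> : [set f b0 | b0 in b :: s] = f b |: [set f b0 | b0 in s].
  apply/setP=> x; rewrite !inE; apply/imsetP/orP.
    case=> y; rewrite inE => /orP[/eqP->|ys] ->; first by left.
    by right; apply: imset_f.
  case=> [/eqP->|/imsetP[y ys ->]]; first by exists b; rewrite ?inE ?eqxx.
  by exists y; rewrite // inE ys orbT.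
have nb : f b \notin [set f b0 | b0 in s].
  by apply: contra bs => /imsetP[y ys /f_inj ->].
rewrite setU11 setU1K // !mulf_neq0 ?IHs //.
by rewrite signr_eq0.
Qed.

Lemma ext_act_basis1 B C : ext_act_basis 1%:M B C = (C == B)%:R :> F.
Proof.
have vE b : col b (1%:M : 'M[F]_n) = 1 *: delta_mx b 0.
  by apply/colP=> i; rewrite !mxE andbT mul1r.
(* The enumeration is increasing, so no reordering sign arises below. *)
have srt : sorted ltn (map val (enum B)).
  rewrite {1}/enum_mem -enumT; apply: (subseq_sorted ltn_trans) (iota_ltn_sorted 0 n).
  by rewrite -val_enum_ord; apply: map_subseq; exact: filter_subseq.
rewrite /ext_act_basis.
have -> : (C == B) = (C == [set:: enum B]).
  by congr (_ == _); apply/setP=> x; rewrite inE mem_enum.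
elim: (enum B) srt C => [_ C|b s IHs /= /[dup] srt /path_sorted /IHs {}IHs C].
  by rewrite big_nil ffunE; congr (_ == _)%:R; apply/setP=> x; rewrite !inE.
have bs : all (ltn b) (map val s) by exact: (order_path_min ltn_trans).
rewrite big_cons vE wedge_ext_vec IHs mul1r.
have bNs : b \notin [set:: s].
  by rewrite inE; apply/negP => /(map_f val) /(allP bs); rewrite /= ltnn.
have -> : [set:: b :: s] = b |: [set:: s] by apply/setP=> x; rewrite !inE.
case: ifP => bC; last first.
  by case: eqP => // E; move: bC; rewrite E setU11.
case: eqP => [E|nE].
  rewrite E /shuffle_sign.
  have -> : [set ij in setX [set b] [set:: s] | (ij.2 < ij.1)%N] = set0.
    apply/setP=> -[i j]; rewrite !inE /=; apply/negP => /andP[/andP[/eqP -> js]].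
    by have := allP bs _ (map_f val js); rewrite /= => /ltnW; rewrite leqNgt => /negPf ->.
  by rewrite cards0 expr0 mul1r -E setD1K // eqxx.
rewrite mulr0; case: eqP => // E; case: nE.
by rewrite E setU1K.
Qed.

End Exterior.

(** * Schur modules in coordinates, and weights *)

Section Tensors.
Variables (F : fieldType) (n : nat).
Implicit Types (g h : 'M[F]_n) (alpha : parts n).

Lemma coltensZ m a (t : coltens F n m) A : (a *: t) A = a * t A.
Proof. by rewrite ffunE. Qed.

Lemma coltensD m (s t : coltens F n m) A : (s + t) A = s A + t A.
Proof. by rewrite ffunE. Qed.

Lemma coltens_sum m I (r : seq I) (t : I -> coltens F n m) A :
  (\sum_(i <- r) t i) A = \sum_(i <- r) t i A.
Proof. by elim/big_ind2: _ => [|? s ? u <- <-|]; rewrite ?ffunE. Qed.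

Lemma coltens_eq0 m (t : coltens F n m) : t = 0 \/ exists A, t A != 0.
Proof.
case: (boolP [exists A, t A != 0]) => [/existsP[A tA]|]; first by right; exists A.
rewrite negb_exists => /forallP t0; left; apply/ffunP=> A.
by rewrite [RHS]ffunE; apply/eqP; rewrite -[_ == _]negbK.
Qed.

Lemma act_linear m g : linear_on (fun=> True) (@act F n m g).
Proof.
move=> a s t _ _; apply/ffunP=> A; rewrite coltensD coltensZ !ffunE.
rewrite mulr_sumr -big_split; apply: eq_bigr => B _ /=.
by rewrite coltensD coltensZ mulrDl mulrA.
Qed.

Lemma actZ m g a (t : coltens F n m) : act g (a *: t) = a *: act g t.
Proof.
have sT : subspace (fun _ : coltens F n m => True) by [].
exact: (linear_onZ a sT (@act_linear m g)).
Qed.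

(** The extra factor [g] gives multiplicativity of the action for a diagonal left factor, which
    [act_torus_schur] uses to keep the orbit of the highest weight tensor stable under the torus. *)
Lemma act_diag m (d : 'I_n -> F) g (t : coltens F n m) A :
  act (diag_mx (\row_i d i) *m g) t A =
  (\prod_c \prod_(i in A c) d i) * act g t A.
Proof.
rewrite !ffunE mulr_sumr; apply: eq_bigr => B _.
under eq_bigr do rewrite ext_act_basis_diag.
by rewrite big_split /= mulrCA.
Qed.

Lemma act1 m (t : coltens F n m) : act 1%:M t = t.
Proof.
apply/ffunP=> A; rewrite ffunE (bigD1 A) //= [X in _ + X]big1 ?addr0 => [|B BA].
  by rewrite big1 ?mulr1 // => c _; rewrite ext_act_basis1 eqxx.
have [c Bc] : exists c, A c != B c.
  apply/existsP; rewrite -negb_forall; apply: contra BA => /forallP AB.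
  by apply/eqP/ffunP=> c; apply/esym/eqP.
by rewrite (bigD1 c) //= ext_act_basis1 (negPf Bc) mul0r mulr0.
Qed.

Definition hw_columns alpha : {ffun 'I_(width alpha) -> {set 'I_n}} :=
  [ffun c : 'I_(width alpha) => [set i : 'I_n | (i < col_height alpha c)%N]].

Lemma hw_tensE alpha : hw_tens F alpha = basis_tens F (hw_columns alpha).
Proof. by []. Qed.

Lemma act_hw_tens alpha g A :
  act g (hw_tens F alpha) A =
  \prod_c ext_act_basis g (hw_columns alpha c) (A c).
Proof.
rewrite ffunE (bigD1 (hw_columns alpha)) //=.
rewrite ffunE eqxx mul1r [X in _ + X]big1 ?addr0 => [|B /negPf BH]//.
by rewrite ffunE BH mul0r.
Qed.

Lemma act_dual_act m g (t : coltens F n m) : act g t = dual_act (invmx g^T) t.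
Proof. by rewrite /dual_act invmxK trmxK. Qed.

(** The inverse transpose is a bijection of the invertible matrices, so in coordinates both modules
    are spanned by the same orbit. *)
Lemma schur_dualP alpha t : schur_dual alpha t <-> @schur F n alpha t.
Proof.
split; apply: in_span_min; try exact: in_span_subspace; move=> {}t [g gU ->];
  apply: in_span_gen.
  by exists (invmx g)^T; rewrite // unitmx_tr unitmx_inv.
by exists (invmx g^T); rewrite ?act_dual_act // unitmx_inv unitmx_tr.
Qed.

Lemma schur_dual_subspace alpha : subspace (@schur_dual F n alpha).
Proof. exact: in_span_subspace. Qed.

Lemma col_height_le alpha c : (col_height alpha c <= n)%N.
Proof. by rewrite -[leqRHS](size_tuple (val alpha)) count_size. Qed.

Lemma card_hw_columns alpha c : #|hw_columns alpha c| = col_height alpha c.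
Proof.
rewrite ffunE; have le := col_height_le alpha c.
have w_inj : injective (widen_ord le) by move=> i j E; apply/val_inj/(congr1 val E).
rewrite -[RHS]card_ord -cardsT -(card_imset setT w_inj).
apply: eq_card => i; rewrite inE; apply/idP/imsetP => [lti|[j _ ->]] /=.
  by exists (Ordinal lti); rewrite ?inE //; apply: val_inj.
exact: ltn_ord.
Qed.

Lemma schur_in_columns alpha t : @schur F n alpha t -> in_columns alpha t.
Proof.
apply: in_span_min => [|{}t [g _ ->] A].
  split=> [A|a s u Ps Pu A]; first by rewrite ffunE eqxx.
  rewrite coltensD coltensZ; case: (eqVneq (s A) 0) => [->|sA _]; last exact: Ps.
  by rewrite mulr0 add0r; exact: Pu.
rewrite act_hw_tens => nz c.
rewrite -[RHS]card_hw_columns; apply: (@ext_act_basis_card F n g).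
by apply: contraNneq nz => E; rewrite (bigD1 c) //= E mul0r.
Qed.

(** The highest weight tensor has equal factors in columns of equal length, hence so do its
    translates, which span the module. *)
Lemma schur_sym alpha t (s : {perm 'I_(width alpha)})
    (A : {ffun 'I_(width alpha) -> {set 'I_n}}) :
  @schur F n alpha t ->
  (forall c, col_height alpha (s c) = col_height alpha c) ->
  t [ffun c => A (s c)] = t A.
Proof.
move=> + sE.
pose Q (u : coltens F n (width alpha)) :=
  forall A : {ffun 'I_(width alpha) -> {set 'I_n}}, u [ffun c => A (s c)] = u A.
move=> St; move: A; rewrite -/(Q t).
apply: in_span_min St => [|{}t [g _ ->] A].
  split=> [A|a u v Pu Pv A]; first by rewrite !ffunE.
  by rewrite !coltensD !coltensZ Pu Pv.
rewrite !act_hw_tens [RHS](reindex_inj (@perm_inj _ s)) /=.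
by apply: eq_bigr => c _; rewrite !ffunE sE.
Qed.

Definition weight m (A : {ffun 'I_m -> {set 'I_n}}) (i : 'I_n) : nat :=
  #|[set c | i \in A c]|.

Lemma weight_perm m (A : {ffun 'I_m -> {set 'I_n}}) (s : {perm 'I_m}) :
  weight [ffun c => A (s c)] =1 weight A.
Proof.
move=> i; rewrite /weight -(card_imset _ (@perm_inj _ s)).
apply: eq_card => c; rewrite inE; apply/imsetP/idP => [[d]|Ac].
  by rewrite inE ffunE => Ad ->.
by exists (s^-1%g c); rewrite ?permKV // inE ffunE permKV.
Qed.

Lemma prod_weight (R : comPzSemiRingType) m (A : {ffun 'I_m -> {set 'I_n}}) (d : 'I_n -> R) :
  \prod_c \prod_(i in A c) d i = \prod_i d i ^+ weight A i.
Proof.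
rewrite (exchange_big_dep predT) //=; apply: eq_bigr => i _.
by rewrite prodr_const; congr (_ ^+ _); apply: eq_card => c; rewrite !inE.
Qed.

Lemma sym_columns_subspace alpha : subspace (@sym_columns F n alpha).
Proof.
split=> [|a u v [Cu Su] [Cv Sv]]; split.
- by move=> A; rewrite ffunE eqxx.
- by move=> s _ A; rewrite !ffunE.
- move=> A; rewrite coltensD coltensZ; case: (eqVneq (u A) 0) => [->|uA _]; last exact: Cu.
  by rewrite mulr0 add0r; exact: Cv.
- by move=> s sE A; rewrite !coltensD !coltensZ Su ?Sv.
Qed.

End Tensors.

(** * Decomposition into torus eigenvectors *)

(* When the integers [q i] are distinct primes, the eigenvalues of diag(q)
   separate the weights, by unique factorization. *)
Section Torus.
Variables (F : numFieldType) (n : nat) (q : 'I_n -> nat).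
Hypothesis q_gt0 : forall i, (0 < q i)%N.
Implicit Types alpha : parts n.

Definition torus : 'M[F]_n := diag_mx (\row_i (q i)%:R).

Definition eigval m (A : {ffun 'I_m -> {set 'I_n}}) : nat :=
  (\prod_i q i ^ weight A i)%N.

Definition eigpart m (v : nat) (t : coltens F n m) : coltens F n m :=
  [ffun A => if eigval A == v then t A else 0].

Lemma torus_unit : torus \in unitmx.
Proof.
rewrite unitmxE det_diag unitfE; apply/prodf_neq0 => i _.
by rewrite mxE pnatr_eq0 -lt0n.
Qed.

Lemma act_torus m g (t : coltens F n m) A :
  act (torus *m g) t A = (eigval A)%:R * act g t A.
Proof.
rewrite act_diag prod_weight; congr (_ * _).
by rewrite natr_prod; apply: eq_bigr => i _; rewrite natrX.
Qed.

Lemma act_torus1 m (t : coltens F n m) A : act torus t A = (eigval A)%:R * t A.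
Proof. by rewrite -[torus]mulmx1 act_torus act1. Qed.

Lemma act_eigpart m v (t : coltens F n m) :
  act torus (eigpart v t) = v%:R *: eigpart v t.
Proof.
apply/ffunP=> A; rewrite act_torus1 coltensZ !ffunE.
by case: eqP => [->|]; rewrite ?mulr0.
Qed.

Lemma act_torus_schur alpha t : @schur F n alpha t -> schur alpha (act torus t).
Proof.
move=> St; have sS : subspace (@schur F n alpha) by exact: in_span_subspace.
apply: (in_span_min (Q := fun u => schur alpha (act torus u)) _ _ St) => [|_ [g gU ->]].
  split=> [|a u v Pu Pv].
    have -> : act torus 0 = 0 :> coltens F n (width alpha).
      by apply/ffunP=> A; rewrite act_torus1 ffunE mulr0.
    by case: sS.
  by rewrite act_linear //; apply: sS.2.
apply: in_span_gen; exists (torus *m g); first by rewrite unitmx_mul torus_unit.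
apply/ffunP=> A; rewrite act_torus1 act_torus //.
Qed.

(* Lagrange interpolation: the eigencomponent is a polynomial in the torus element. *)
Lemma eigpart_schur alpha v t :
  schur_dual alpha t -> @schur_dual F n alpha (eigpart v t).
Proof.
move=> /schur_dualP St; apply/schur_dualP.
have sS : subspace (@schur F n alpha) by exact: in_span_subspace.
pose L (s : seq nat) (A : {ffun 'I_(width alpha) -> {set 'I_n}}) : F :=
  \prod_(u <- s) ((eigval A)%:R - u%:R).
pose T s : coltens F n (width alpha) :=
  [ffun A : {ffun 'I_(width alpha) -> {set 'I_n}} => L s A * t A].
have ST s : schur alpha (T s).
  elim: s => [|u s IHs].
    have -> // : T [::] = t.
    by apply/ffunP=> A; rewrite ffunE /L big_nil mul1r.
  have -> : T (u :: s) = (- u%:R) *: T s + act torus (T s).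
    apply/ffunP=> A; rewrite coltensD coltensZ act_torus1 !ffunE /L big_cons; ring.
  by apply: sS.2 => //; exact: act_torus_schur.
(* The other eigenvalues, possibly repeated; the normalizing scalar below repeats its factors in the
   same way. *)
pose vs := [seq u <- [seq eigval A | A : {ffun 'I_(width alpha) -> {set 'I_n}}] | u != v].
have -> : eigpart v t = (\prod_(u <- vs) (v%:R - u%:R))^-1 *: T vs.
  apply/ffunP=> A; rewrite coltensZ !ffunE; case: (eqVneq (eigval A) v) => [Av|Av].
    rewrite /L Av mulKf // prodf_seq_neq0; apply/allP => u.
    by rewrite mem_filter subr_eq0 eqr_nat eq_sym => /andP[].
  rewrite /L [X in _ * (X * _)](big_rem (eigval A)) /= ?subrr ?mul0r ?mulr0 //.
  by rewrite mem_filter Av; apply/mapP; exists A; rewrite ?mem_enum.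
exact: subspaceZ.
Qed.

Lemma eigpart_sum m (t : coltens F n m) :
  t = \sum_(v < (\max_(A : {ffun 'I_m -> {set 'I_n}}) eigval A).+1) eigpart v t.
Proof.
apply/ffunP=> A; rewrite coltens_sum.
have ltA : (eigval A < (\max_(A : {ffun 'I_m -> {set 'I_n}}) eigval A).+1)%N.
  by rewrite ltnS leq_bigmax.
rewrite (bigD1 (Ordinal ltA)) //= ffunE eqxx big1 ?addr0 // => v vA.
rewrite ffunE; case: eqP => // E; case/eqP: vA; exact: val_inj.
Qed.

Lemma eigval_perm m (A : {ffun 'I_m -> {set 'I_n}}) (s : {perm 'I_m}) :
  eigval [ffun c => A (s c)] = eigval A.
Proof. by apply: eq_bigr => i _; rewrite weight_perm. Qed.

Lemma eigpart_sym_columns alpha v t :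
  sym_columns alpha t -> @sym_columns F n alpha (eigpart v t).
Proof.
move=> [Ct St]; split=> [A|s sE A]; rewrite !ffunE ?eigval_perm ?St //.
by case: ifP; rewrite ?eqxx //; move=> _; exact: Ct.
Qed.

Lemma eigvec_supp m v (t : coltens F n m) A :
  act torus t = v%:R *: t -> t A != 0 -> eigval A = v.
Proof.
move=> /ffunP/(_ A); rewrite act_torus1 coltensZ => E tA.
by apply/eqP; rewrite -(eqr_nat F); apply/eqP/(mulIf tA).
Qed.

End Torus.

(** * Three indices: weights from prime valuations, and tuples of columns of shape (4, 2) *)

Section ThreeRows.
Implicit Types (i j : 'I_3) (alpha : parts 3).

Lemma ord3P i : [\/ i = 0, i = 1 | i = ord_max].
Proof.
by case: i => -[|[|[|//]]] lti; [constructor 1 | constructor 2 | constructor 3]; apply: val_inj.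
Qed.

Definition prime3 i : nat := nth 0%N [:: 2; 3; 5] i.

Lemma prime3_gt0 i : (0 < prime3 i)%N.
Proof. by case: (ord3P i) => ->. Qed.

Lemma logn_prime3 (w : 'I_3 -> nat) j :
  logn (prime3 j) (\prod_i prime3 i ^ w i) = w j.
Proof.
rewrite !big_ord_recl big_ord0 muln1.
have E0 : (ord0 : 'I_3) = 0 by [].
have E1 : lift ord0 ord0 = 1 :> 'I_3 by apply: val_inj.
have E2 : lift ord0 (lift ord0 ord0) = ord_max :> 'I_3 by apply: val_inj.
rewrite E0 E1 E2 !lognM ?muln_gt0 ?expn_gt0 ?prime3_gt0 // !lognX.
by case: (ord3P j) => ->; rewrite /prime3 /= !logn_prime //= !muln0 !muln1 ?addn0 ?add0n.
Qed.

Lemma eigval_weight m (A : {ffun 'I_m -> {set 'I_3}}) (w : 'I_3 -> nat) :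
  eigval prime3 A = (\prod_i prime3 i ^ w i)%N -> weight A =1 w.
Proof. by move=> E j; rewrite -(logn_prime3 (weight A)) -/(eigval _ A) E logn_prime3. Qed.

Lemma eigval_mul_weight k l m (A : {ffun 'I_k -> {set 'I_3}})
    (B : {ffun 'I_l -> {set 'I_3}}) (C : {ffun 'I_m -> {set 'I_3}}) i :
  (eigval prime3 A * eigval prime3 B)%N = eigval prime3 C ->
  (weight A i + weight B i)%N = weight C i.
Proof.
rewrite /eigval -big_split /= => E; symmetry; move: i; apply: eigval_weight.
by rewrite /eigval -E; apply: eq_bigr => i _; rewrite expnD.
Qed.

Lemma parts3P alpha : exists a b e : nat,
  [/\ (e <= b <= a)%N, width alpha = a,
      forall c, col_height alpha c = ((c < a) + (c < b) + (c < e))%N &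
      forall i, part_row alpha i = nth 0%N [:: a; b; e] i].
Proof.
case: alpha => -[[|a [|b [|e [|]]]] //= sz] srt.
exists a, b, e; split=> //.
- by move: srt => /= /andP[-> /andP[-> _]].
- by move=> c; rewrite /col_height /= addn0 addnA.
by move=> i; rewrite /part_row (tnth_nth 0%N).
Qed.

Lemma part42E : [/\ width part42 = 4%N,
  forall c, col_height part42 c = ((c < 4) + (c < 2))%N &
  forall i, part_row part42 i = nth 0%N [:: 4; 2; 0] i].
Proof.
split=> //; first by move=> c; rewrite /col_height /= !addn0.
by move=> i; rewrite /part_row (tnth_nth 0%N).
Qed.

Lemma in_hw_columns42 (c : 'I_(width part42)) i :
  (i \in hw_columns part42 c) = (i <= (c < 2))%N.
Proof.
case: part42E => _ h _; rewrite ffunE inE h.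
by have -> : (c < 4)%N by exact: ltn_ord.
Qed.

(** All four columns contain [i] and none contains the last index, so the lengths force each column.
    With [i] = 0 or 1 this says that the weights (4, 2, 0) and (2, 4, 0) have multiplicity one. *)
Lemma columns42_uniq (i : 'I_3) (A B : {ffun 'I_(width part42) -> {set 'I_3}}) :
  i != ord_max ->
  (forall c, #|A c| = col_height part42 c) ->
  (forall c, #|B c| = col_height part42 c) ->
  weight A i = 4%N -> weight B i = 4%N ->
  weight A ord_max = 0%N -> weight B ord_max = 0%N -> A = B.
Proof.
move=> i2.
pose X (c : 'I_(width part42)) : {set 'I_3} := if (c < 2)%N then ~: [set ord_max] else [set i].
suff XE (C : {ffun 'I_(width part42) -> {set 'I_3}}) :
    (forall c, #|C c| = col_height part42 c) ->
    weight C i = 4%N -> weight C ord_max = 0%N -> forall c, C c = X c.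
  move=> hA hB A4 B4 A0 B0; apply/ffunP=> c.
  by rewrite (XE A) ?(XE B).
move=> hC C4 C0 c.
have iC : i \in C c.
  have : [set c | i \in C c] = setT.
    by apply/eqP; rewrite eqEcard subsetT cardsT card_ord -/(weight C i) C4.
  by move/setP/(_ c); rewrite !inE.
have mC : ord_max \notin C c.
  move/eqP: C0; rewrite cards_eq0 => /eqP/setP/(_ c).
  by rewrite !inE => ->.
have hc : #|C c| = (1 + (c < 2))%N.
  by case: part42E => _ h _; rewrite hC h; have -> : (c < 4)%N by exact: ltn_ord.
rewrite /X; case: ifP hc => _ hc; apply/eqP.
  by rewrite eqEcard hc cardsCs setCK cards1 card_ord andbT subsetC sub1set inE.
by rewrite eq_sym eqEcard sub1set iC hc cards1.
Qed.

Lemma weight_tableauS : [/\ weight tableauS 0 = 2%N, weight tableauS 1 = 4%N &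
  weight tableauS ord_max = 0%N].
Proof.
by split; rewrite /weight -sum1_card big_mkcond /= !big_ord_recl big_ord0;
  rewrite !inE !ffunE /= !inE.
Qed.

Lemma tableauS_card c : #|tableauS c| = col_height part42 c.
Proof.
case: part42E => _ -> _; rewrite ffunE.
case: c => -[|[|[|[|//]]]] ltc /=; rewrite ?cards1 //.
all: by rewrite cards2.
Qed.

End ThreeRows.

(** * Apolar forms vanish at low weights *)

Section Apolar.
Variable F : numFieldType.
Implicit Types (alpha : parts 3).

Lemma low_weight_columns alpha (phi : coltens F 3 (width alpha))
    (A : {ffun 'I_(width alpha) -> {set 'I_3}}) :
  schur alpha phi -> phi A != 0 ->
  (weight A 0%R <= 2)%N -> (weight A 1%R <= 2)%N -> weight A ord_max = 0%N ->
  part_sub alpha part42 /\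
  exists2 B, phi B != 0 &
    forall c : 'I_(width part42), column B c \subset hw_columns part42 c.
Proof.
move=> Sphi phiA w0 w1 w2.
have hA := schur_in_columns Sphi.
have [a [b [e [/andP[eb ba] wa ha ra]]]] := parts3P alpha.
have no2 (B : {ffun 'I_(width alpha) -> {set 'I_3}}) : weight B ord_max = 0%N ->
    forall c, ord_max \notin B c.
  move=> /eqP + c; rewrite cards_eq0 => /eqP/setP/(_ c).
  by rewrite !inE => ->.
have sub2 (B : {ffun 'I_(width alpha) -> {set 'I_3}}) : weight B ord_max = 0%N ->
    forall c, B c \subset ~: [set ord_max].
  by move=> /no2 B2 c; rewrite subsetC sub1set inE.
have c2 : #|~: [set (ord_max : 'I_3)]| = 2%N by rewrite cardsCs setCK cards1 card_ord.
have e0 : e = 0%N.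
  apply/eqP; rewrite -leqn0 leqNgt; apply/negP => e_gt0.
  have lt0 : (0 < width alpha)%N by rewrite wa; lia.
  have := subset_leq_card (sub2 A w2 (Ordinal lt0)).
  by rewrite c2 (hA A) // ha /=; lia.
(* Each of the first [b] columns has length two and avoids the last index, so it contains 0. *)
have b2 : (b <= 2)%N.
  apply: leq_trans w0.
  have leb : (b <= width alpha)%N by rewrite wa.
  have w_inj : injective (widen_ord leb) by move=> i j E; apply/val_inj/(congr1 val E).
  rewrite -[b]card_ord -cardsT -(card_imset setT w_inj).
  apply/subset_leq_card/subsetP => _ /imsetP[j _ ->]; rewrite inE.
  have -> : A (widen_ord leb j) = ~: [set ord_max].
    apply/eqP; rewrite eqEcard sub2 // c2 (hA A) // ha /=.
    by have := ltn_ord j; lia.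
  by rewrite !inE.
(* Every column is nonempty, hence counted by the weight of 0 or of 1. *)
have a4 : (a <= 4)%N.
  rewrite -wa -[width alpha]card_ord -cardsT.
  apply: leq_trans (_ : (weight A 0%R + weight A 1%R <= 4)%N); last by lia.
  apply: leq_trans (leq_card_setU _ _); apply/subset_leq_card/subsetP => c _.
  rewrite !inE; have : (0 < #|A c|)%N by rewrite (hA A) // ha; have := ltn_ord c; lia.
  case/card_gt0P => i; case: (ord3P i) => -> iA; rewrite ?iA ?orbT //.
  by rewrite (negPf (no2 A w2 c)) in iA.
split.
  apply/forallP=> i; rewrite ra; have [_ _ ->] := part42E.
  by case: (ord3P i) => ->; rewrite /= ?e0.
(* The columns that stick out of [hw_columns part42]: beyond the first two, only 0 is allowed.
   Transpositions of columns reduce their number while keeping the coordinate of [phi] nonzero. *)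
pose bad (B : {ffun 'I_(width alpha) -> {set 'I_3}}) :=
  [set c : 'I_(width alpha) | (2 <= c)%N && (1 \in B c)].
have [k] := ubnP #|bad A|; elim: k => // k IHk in A phiA w0 w1 w2 *.
move=> ltk; have [bad0|] := eqVneq (bad A) set0.
  exists A => // c; rewrite /column; case: insubP => [d _ dc|_] /=; last exact: sub0set.
  apply/subsetP => i iA; rewrite in_hw_columns42 -dc.
  case: (ord3P i) iA => -> // iA; last by rewrite (negPf (no2 A w2 d)) in iA.
  move/setP/(_ d): bad0; rewrite !inE iA andbT => /negbT; rewrite -ltnNge => ->.
  by [].
case/set0Pn=> c; rewrite inE => /andP[c_ge2 A1c].
(* At most two columns contain 1 and [c] is one of them, so 1 misses column 0 or column 1. *)
have [d [d_lt2 A1d]] : exists d : 'I_(width alpha), (d < 2)%N /\ 1 \notin A d.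
  have lt0 : (0 < width alpha)%N by have := ltn_ord c; lia.
  have lt1 : (1 < width alpha)%N by have := ltn_ord c; lia.
  case: (boolP (1 \in A (Ordinal lt0))) => A0; last by exists (Ordinal lt0).
  case: (boolP (1 \in A (Ordinal lt1))) => A1; last by exists (Ordinal lt1).
  have : (#|[set Ordinal lt0; Ordinal lt1; c]| <= 2)%N.
    apply: leq_trans w1; apply/subset_leq_card/subsetP => x.
    by rewrite !inE => /orP[/orP[]|] /eqP ->.
  rewrite setUC cardsU1 cards2 !inE -!val_eqE /=.
  by case: (nat_of_ord c) c_ge2 => [|[|]].
have cd : c != d by apply: contraTneq c_ge2 => ->; rewrite -ltnNge.
have hc : col_height alpha c = 1%N by rewrite ha; have := ltn_ord c; lia.
have hd : col_height alpha d = 1%N.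
  have : (#|A d| <= 1)%N.
    rewrite -[leqRHS](cards1 (0 : 'I_3)); apply/subset_leq_card/subsetP => i iA; rewrite inE.
    case: (ord3P i) iA => -> // iA; last by rewrite (negPf (no2 A w2 d)) in iA.
    by rewrite iA in A1d.
  by rewrite (hA A) // ha; have := ltn_ord d; lia.
pose s := tperm c d.
have sh x : col_height alpha (s x) = col_height alpha x.
  by rewrite /s; case: tpermP => // ->; rewrite hc hd.
apply: (IHk [ffun x => A (s x)]); rewrite ?weight_perm //.
  by rewrite schur_sym.
apply: (@leq_trans #|bad A|) => //; apply: proper_card; rewrite properE; apply/andP; split.
  apply/subsetP => x; rewrite !inE ffunE /s => /andP[x_ge2].
  case: tpermP => [_|xd|_ _ ->]; last by rewrite x_ge2.
    by rewrite (negPf A1d).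
  by rewrite xd leqNgt d_lt2 in x_ge2.
apply/subsetPn; exists c; rewrite !inE ?c_ge2 ?A1c //.
by rewrite ffunE tpermL negb_and A1d orbT.
Qed.

(** At the complement of [A] in the highest weight columns, the contraction has a single term: a
    tuple disjoint from this complement whose union with it gives those columns must be [A]. *)
Lemma contract_hw_tens alpha (phi : coltens F 3 (width alpha)) a
    (A : {ffun 'I_(width alpha) -> {set 'I_3}}) :
  a != 0 -> part_sub alpha part42 ->
  contract alpha part42 phi (a *: hw_tens F part42) = 0 ->
  (forall c : 'I_(width part42), column A c \subset hw_columns part42 c) ->
  phi A = 0.
Proof.
move=> a0 sub_a; rewrite /contract sub_a hw_tensE.
move: (hw_columns part42) => H + AH.
have wa : (width alpha <= width part42)%N.
  have [x [y [z [_ -> _ rx]]]] := parts3P alpha.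
  by move/forallP/(_ 0): sub_a; rewrite rx; have [-> _ ->] := part42E.
move/ffunP/(_ [ffun c : 'I_(width part42) => H c :\: column A c]).
rewrite !ffunE (bigD1 A) /=; last first.
  by apply/forallP=> c; rewrite ffunE -setI_eq0 setDE setICA setICr setI0.
rewrite [X in _ + X]big1 ?addr0 => [|B /andP[/forallP dis BA]].
  rewrite coltensZ ffunE; case: eqP => [_|nE].
    rewrite mulr1 => /eqP; rewrite !mulf_eq0 (negPf a0) orbF.
    by case/orP=> [/eqP //|/prodf_eq0[c _]]; rewrite signr_eq0.
  case: nE; apply/ffunP=> c; rewrite !ffunE; apply/setP=> x; rewrite !inE.
  by move/subsetP/(_ x): (AH c); case: (x \in column A c) => //= ->.
rewrite coltensZ ffunE; case: eqP => [E|_]; last by rewrite !mulr0.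
case/eqP: BA; apply/ffunP=> c.
have ltc : (c < width part42)%N := leq_trans (ltn_ord c) wa.
have colE (C : {ffun 'I_(width alpha) -> {set 'I_3}}) : column C c = C c.
  by rewrite /column valK.
move/ffunP/(_ (Ordinal ltc)): E; have := dis (Ordinal ltc); rewrite !ffunE /= !colE.
have := AH (Ordinal ltc); rewrite /= colE => /subsetP AHc.
rewrite -setI_eq0 => /eqP/setP dB /setP E; apply/setP=> x.
move: (dB x) (E x) (AHc x); rewrite !inE.
by case: (x \in A c) (x \in B c) (x \in H _) => [] [] [] //= _ _ H0; have := H0 isT.
Qed.

End Apolar.

(** * The line of [xS], and products of apolar forms *)

Section FlagVariety.
Variable F : numFieldType.
Implicit Types (alpha beta : parts 3).
Local Notation T := (torus F prime3).
Local Notation tens := (coltens F 3 (width part42)).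

Let T_unit : T \in unitmx := torus_unit F prime3_gt0.

Lemma schur_supp alpha (t : coltens F 3 (width alpha)) A c :
  schur alpha t -> t A != 0 -> #|A c| = col_height alpha c.
Proof. by move=> /schur_in_columns h /h. Qed.

Lemma basis_tens_scale m (t : coltens F 3 m) B :
  (forall A, t A != 0 -> A = B) -> t = t B *: basis_tens F B.
Proof.
move=> tB; apply/ffunP=> A; rewrite coltensZ ffunE.
case: eqP => [->|AB]; first by rewrite mulr1.
by rewrite mulr0; apply/eqP; apply: contra_notT AB => /tB.
Qed.

Lemma weight_hw_columns42 :
  weight (hw_columns part42) 0%R = 4%N /\ weight (hw_columns part42) ord_max = 0%N.
Proof.
split.
  rewrite /weight (_ : [set c | _] = setT) ?cardsT ?card_ord //.
  by apply/setP=> c; rewrite !inE in_hw_columns42.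
rewrite /weight (_ : [set c | _] = set0) ?cards0 //.
by apply/setP=> c; rewrite !inE in_hw_columns42 /=; case: (c < 2)%N.
Qed.

Lemma highest_weight_vectorE (p : tens) :
  highest_weight_vector part42 p -> exists2 a, a != 0 & p = a *: hw_tens F part42.
Proof.
move=> [Sp p0 wp].
have Tp : act T p = (\prod_i prime3 i ^ part_row part42 i)%:R *: p.
  rewrite wp //; last by move=> i j ij; rewrite !mxE; case: eqP => // E; rewrite E ltnn in ij.
  by rewrite natr_prod; congr (_ *: _); apply: eq_bigr => i _; rewrite !mxE eqxx natrX.
have pE : p = p (hw_columns part42) *: basis_tens F (hw_columns part42).
  apply: basis_tens_scale => A pA.
  have wA := eigval_weight (eigvec_supp Tp pA); have [H0 H2] := weight_hw_columns42.
  have [_ _ r42] := part42E.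
  apply: (@columns42_uniq 0) => //; rewrite ?wA ?r42 //.
    by move=> c; exact: schur_supp pA.
  by move=> c; rewrite card_hw_columns.
exists (p (hw_columns part42)) => //.
by apply: contra_neq p0 => E; rewrite pE E scale0r.
Qed.

Lemma eigvec_tableauS (t : tens) :
  in_columns part42 t -> act T t = (eigval prime3 tableauS)%:R *: t ->
  t = t tableauS *: basis_tens F tableauS.
Proof.
move=> Ct Tt; apply: basis_tens_scale => A tA.
have wA := eigval_weight (eigvec_supp Tt tA); have [_ S1 S2] := weight_tableauS.
apply: (@columns42_uniq 1) => //; rewrite ?wA //; first by move=> c; exact: Ct tA _.
exact: tableauS_card.
Qed.

Lemma act_basis_tens m (B : {ffun 'I_m -> {set 'I_3}}) :
  act T (basis_tens F B) = (eigval prime3 B)%:R *: basis_tens F B.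
Proof.
by apply/ffunP=> A; rewrite act_torus1 coltensZ ffunE; case: eqP => [->|]; rewrite ?mulr0.
Qed.

Lemma tableauS_sym : sym_columns part42 (basis_tens F tableauS).
Proof.
split=> [A|s sE A].
  by rewrite ffunE; case: (A =P tableauS) => [-> _ c|_]; rewrite ?eqxx ?tableauS_card.
have S_s (r : {perm 'I_(width part42)}) :
    (forall c, col_height part42 (r c) = col_height part42 c) ->
    [ffun c => tableauS (r c)] = tableauS.
  move=> rE; apply/ffunP=> c; have := rE c; rewrite -!tableauS_card !ffunE.
  case: (r c) => -[|[|[|[|//]]]] /= _; case: c => -[|[|[|[|//]]]] /= _;
    by rewrite ?cards1 ?cards2.
rewrite !ffunE; congr (_ %:R); congr nat_of_bool; apply/eqP/eqP => [E|->]; last exact: S_s.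
rewrite -(S_s s^-1%g); last by move=> c; rewrite -[in RHS](permKV s c) sE.
by apply/ffunP=> c; rewrite ffunE -E ffunE permKV.
Qed.

(** The reflection exchanging the first two basis vectors carries the highest weight columns to
    [tableauS]. *)
Lemma schur_tableauS : exists2 phi : tens, schur_dual part42 phi & phi tableauS != 0.
Proof.
pose s := tperm (0 : 'I_3) 1; pose h := perm_mx s : 'M[F]_3.
exists (act h (hw_tens F part42)).
  by apply/schur_dualP/in_span_gen; exists h; rewrite // unitmx_perm.
rewrite act_hw_tens; apply/prodf_neq0 => c _.
have -> : tableauS c = s @: hw_columns part42 c.
  rewrite (can_imset_pre _ (tpermK 0 1)); apply/setP=> i.
  rewrite inE in_hw_columns42 ffunE.
  case: c => -[|[|[|[|//]]]] /= _; rewrite !inE;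
    by case: (ord3P i) => ->; rewrite ?tpermL ?tpermR ?tpermD.
apply: (@ext_act_basis_mono _ _ h (fun=> 1)) => [|b|b]; first exact: perm_inj.
  exact: oner_neq0.
apply/colP=> i; rewrite !mxE mul1r andbT; congr (_ %:R); congr nat_of_bool.
by rewrite -(inj_eq (@perm_inj _ s)) tpermK.
Qed.

Lemma xS_tens (pi : tens -> tens) :
  cartan_projection part42 pi -> exists2 a, a != 0 & xS pi = a *: basis_tens F tableauS.
Proof.
move=> [linpi Spi Gpi surpi].
have sY := @sym_columns_subspace F 3 part42.
have Tpi v t : sym_columns part42 t -> act T t = v%:R *: t ->
    act T (pi t) = v%:R *: pi t.
  move=> Yt Tt; rewrite act_dual_act -Gpi //; last by rewrite unitmx_inv unitmx_tr.
  by rewrite -act_dual_act Tt (linear_onZ _ sY linpi).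
have bE : xS pi = xS pi tableauS *: basis_tens F tableauS.
  apply: eigvec_tableauS; last by apply: Tpi (act_basis_tens _); exact: tableauS_sym.
  by apply: schur_in_columns; apply/schur_dualP/Spi/tableauS_sym.
(* If [xS pi] vanished, so would the coordinate at [tableauS] on the whole image of [pi]: only the
   eigenpart of a preimage with the eigenvalue of [tableauS] contributes, and it is a multiple of
   the basis tensor. This contradicts surjectivity. *)
exists (xS pi tableauS) => //; apply/negP => /eqP xS0.
have [phi Sphi] := schur_tableauS; have [t Yt <-] := surpi _ Sphi.
have Yv v : sym_columns part42 (eigpart prime3 v t) by exact: eigpart_sym_columns.
rewrite (eigpart_sum prime3 t) (linear_on_sum _ sY linpi) // coltens_sum.
case/negP; apply/eqP/big1 => v _; apply/eqP; apply: contraT => pi_v.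
have Tv := act_eigpart prime3 v t.
have Sv := eigvec_supp (Tpi _ _ (Yv v) Tv) pi_v.
rewrite -Sv in Tv pi_v.
move: pi_v; rewrite (eigvec_tableauS _ Tv); last by case: (Yv (eigval prime3 tableauS)).
rewrite (linear_onZ _ sY linpi tableauS_sym) coltensZ.
by rewrite -[pi _]/(xS pi) xS0 mulr0 eqxx.
Qed.

Lemma low_weight_apolar alpha (phi : coltens F 3 (width alpha)) a
    (A : {ffun 'I_(width alpha) -> {set 'I_3}}) :
  a != 0 -> schur alpha phi ->
  contract alpha part42 phi (a *: hw_tens F part42) = 0 ->
  (weight A 0%R <= 2)%N -> (weight A 1%R <= 2)%N -> weight A ord_max = 0%N ->
  phi A = 0.
Proof.
move=> a0 Sphi c0 w0 w1 w2; apply/eqP; apply: contraT => phiA.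
have [sub_a [B phiB BH]] := low_weight_columns Sphi phiA w0 w1 w2.
by rewrite (contract_hw_tens a0 sub_a c0 BH) eqxx in phiB.
Qed.

Lemma apolar_product M alpha beta phi psi a :
  equivariant_maps M -> a != 0 ->
  schur_dual alpha phi -> contract alpha part42 phi (a *: hw_tens F part42) = 0 ->
  schur_dual beta psi -> contract beta part42 psi (a *: hw_tens F part42) = 0 ->
  M alpha beta part42 phi psi tableauS = 0.
Proof.
move=> HM a0 Sphi cphi Spsi cpsi; have [[Ml Mr] SM GM] := HM alpha beta part42.
have sA := @schur_dual_subspace F 3 alpha; have sB := @schur_dual_subspace F 3 beta.
have Se := eigpart_schur prime3_gt0.
rewrite (eigpart_sum prime3 phi) (linear_on_sum _ sA (Ml _ Spsi)); last first.
  by move=> v; exact: Se.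
rewrite coltens_sum big1 // => v _.
rewrite (eigpart_sum prime3 psi) (linear_on_sum _ sB (Mr _ (Se _ _ _ _ Sphi))); last first.
  by move=> u; exact: Se.
rewrite coltens_sum big1 // => u _.
set f := eigpart _ _ phi; set g := eigpart _ _ psi.
have Sf : schur_dual alpha f by exact: Se.
have Sg : schur_dual beta g by exact: Se.
have TM : act T (M alpha beta part42 f g) = (v * u)%:R *: M alpha beta part42 f g.
  rewrite act_dual_act -GM //; last by rewrite unitmx_inv unitmx_tr.
  rewrite -!act_dual_act !act_eigpart.
  rewrite (linear_onZ _ sA (Ml _ _)) ?(linear_onZ _ sB (Mr _ _)) //; last exact: subspaceZ.
  by rewrite scalerA natrM.
have [->|[A fA]] := coltens_eq0 f; first by rewrite (linear_on0 sA (Ml _ _)) // ffunE.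
have [->|[B gB]] := coltens_eq0 g; first by rewrite (linear_on0 sB (Mr _ _)) // ffunE.
apply/eqP; apply: contraT => MS.
have vu := eigvec_supp TM MS.
move: fA gB; rewrite !ffunE.
case: (eigval prime3 A =P v) => [Av phiA|]; last by rewrite eqxx.
case: (eigval prime3 B =P u) => [Bu psiB|]; last by rewrite eqxx.
have w i : (weight A i + weight B i)%N = weight tableauS i.
  by apply: eigval_mul_weight; rewrite Av Bu vu.
have := (w 0, w 1, w ord_max); have [-> -> ->] := weight_tableauS.
(* The two weights of 1 add up to 4, so one is at most 2; those of 0 add up to 2 and those of the
   last index to 0. *)
case=> [[w0 w1] w2]; case: (leqP (weight A 1) 2) => wA.
  move: phiA; rewrite (low_weight_apolar a0 _ cphi) ?eqxx //; try lia.
  exact/schur_dualP.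
move: psiB; rewrite (low_weight_apolar a0 _ cpsi) ?eqxx //; try lia.
exact/schur_dualP.
Qed.

Lemma ideal_square_tableauS M (p : tens) z :
  equivariant_maps M -> highest_weight_vector part42 p ->
  ideal_square M (apolar_ideal part42 p) z -> z part42 tableauS = 0.
Proof.
move=> HM /highest_weight_vectorE[a a0 ->] [k [b [phi [psi [I_ ->]]]]].
rewrite coltens_sum big1 // => i _; rewrite coltensZ /diamond coltens_sum.
rewrite big1 ?mulr0 // => ab _.
have [[[Sphi _] cphi] [[Spsi _] cpsi]] := I_ i.
apply: (apolar_product HM a0) => //.
Qed.

(** * Tangent vectors and the conic relation *)

Definition mpoly_diff n (f : {mpoly F[n]}) (x w : 'I_n -> F) : F :=
  \sum_i (f^`M(i)).@[x] * w i.

Lemma mpoly_diffB n (f g : {mpoly F[n]}) x w :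
  mpoly_diff (f - g) x w = mpoly_diff f x w - mpoly_diff g x w.
Proof.
by rewrite -sumrB; apply: eq_bigr => i _; rewrite mderivB mevalB mulrBl.
Qed.

Lemma mpoly_diffM n (f g : {mpoly F[n]}) x w :
  mpoly_diff (f * g) x w = mpoly_diff f x w * g.@[x] + f.@[x] * mpoly_diff g x w.
Proof.
rewrite mulr_suml mulr_sumr -big_split; apply: eq_bigr => i _ /=.
by rewrite mderivM mevalD !mevalM; ring.
Qed.

Lemma mpoly_diffX n (i : 'I_n) x w : mpoly_diff 'X_i x w = w i.
Proof.
rewrite /mpoly_diff (bigD1 i) //= [X in _ + X]big1 => [|j ji].
  rewrite mderivX mevalZ mnm1E eqxx mul1r mevalX big1 ?mul1r ?addr0 // => k _.
  by rewrite mnmBE subnn expr0.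
by rewrite mderivX mevalZ mnm1E eq_sym (negPf ji) !mul0r.
Qed.

Lemma affine_tangent_tableauS (p w : tens) :
  highest_weight_vector part42 p -> affine_tangent p w -> w tableauS = 0.
Proof.
move=> /highest_weight_vectorE[a a0 ->].
pose H := hw_columns part42.
(* [H], [Q] and [tableauS] agree in the two long columns; their short columns carry 0, 0, then 0, 1,
   then 1, 1. *)
pose Q : {ffun 'I_(width part42) -> {set 'I_3}} :=
  [ffun c : 'I_(width part42) => if (c < 3)%N then H c else tableauS c].
pose X (A : {ffun 'I_(width part42) -> {set 'I_3}}) :=
  'X_(enum_rank A) : {mpoly F[#|{ffun 'I_(width part42) -> {set 'I_3}}|]}.
have SH : tableauS != H.
  by apply/eqP => /ffunP/(_ ord_max)/setP/(_ 0); rewrite in_hw_columns42 ffunE !inE.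
have QH : Q != H.
  apply/eqP => /ffunP/(_ ord_max)/setP/(_ 0).
  by rewrite in_hw_columns42 !ffunE /= !inE.
have XE A t : (X A).@[coords t] = t A by rewrite mevalXU /coords enum_rankK.
have dX A x : mpoly_diff (X A) x (coords w) = w A by rewrite mpoly_diffX /coords enum_rankK.
(* At a multiple of the basis tensor of [H] the coordinates at [Q] and [tableauS] are zero, so only
   the differential of [X tableauS] survives. *)
move/(_ (X tableauS * X H - X Q * X Q)); rewrite -/(mpoly_diff _ _ _).
rewrite mpoly_diffB !mpoly_diffM !XE !dX.
have hE A : (a *: hw_tens F part42) A = a * (A == H)%:R by rewrite coltensZ ffunE.
rewrite !hE eqxx (negPf QH) (negPf SH) !mulr0 !mul0r !mulr1 ?addr0 ?subr0 => wa.
apply: (mulIf a0); rewrite mul0r; apply: wa => x [b [g [_ ->]]]; rewrite mevalB !mevalM !XE.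
rewrite actZ !coltensZ !act_hw_tens.
have SE (c : 'I_(width part42)) : (c < 2)%N -> tableauS c = H c.
  move=> c2; apply/setP=> i; rewrite in_hw_columns42 ffunE c2.
  by case: c c2 => -[|[|//]] /= _ _; rewrite !inE; case: (ord3P i) => ->.
pose c2 : 'I_(width part42) := @Ordinal 4 2 isT.
pose c3 : 'I_(width part42) := @Ordinal 4 3 isT.
have H23 : H c2 = H c3 by apply/setP=> i; rewrite !in_hw_columns42.
have S23 : tableauS c2 = tableauS c3 by rewrite !ffunE.
(* The common factor of the long columns; both short columns contribute entries of the first column
   of [g], so the conic relation becomes an identity of products. *)
pose E := \prod_(c < width part42 | (c < 2)%N) ext_act_basis g (H c) (H c).
have tE (A : {ffun 'I_(width part42) -> {set 'I_3}}) :
    (forall c : 'I_(width part42), (c < 2)%N -> A c = H c) ->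
    \prod_c ext_act_basis g (H c) (A c) =
    E * (ext_act_basis g (H c3) (A c2) * ext_act_basis g (H c3) (A c3)).
  move=> AH; rewrite (bigID (fun c : 'I_(width part42) => (c < 2)%N)) /=; congr (_ * _).
    by apply: eq_bigr => c /AH ->.
  rewrite (bigD1 c2) //= (bigD1 c3) //= big1 ?mulr1 ?H23 //.
  by case=> -[|[|[|[|//]]]].
have [Q2 Q3] : Q c2 = H c3 /\ Q c3 = tableauS c3 by rewrite !ffunE.
rewrite !tE //; last by move=> c lec; rewrite ffunE ltnS ltnW.
rewrite S23 H23 Q2 Q3; ring.
Qed.

End FlagVariety.

Theorem proposition3p17 (R : realType)
    (M : structure_maps (R[i])%C 3)
    (HM : equivariant_maps M)
    (pi : coltens (R[i])%C 3 (width part42) -> coltens (R[i])%C 3 (width part42))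
    (Hpi : cartan_projection part42 pi)
    (p : coltens (R[i])%C 3 (width part42))
    (Hp : highest_weight_vector part42 p) :
  (annihilator part42 (affine_tangent p) (xS pi) /\
   ~ component (ideal_square M (apolar_ideal part42 p)) part42 (xS pi)) /\
  ~ (forall phi : coltens (R[i])%C 3 (width part42),
       annihilator part42 (affine_tangent p) phi <->
       component (ideal_square M (apolar_ideal part42 p)) part42 phi).
Proof.
have [a a0 xE] := xS_tens Hpi.
have ann : annihilator part42 (affine_tangent p) (xS pi).
  split; first by case: Hpi => _ h _ _; apply/h/tableauS_sym.
  (* Pairing with [xS pi] only sees the coordinate of [w] at [tableauS]. *)
  move=> w Tw; rewrite /pairing big1 // => A _; rewrite xE coltensZ ffunE.
  case: eqP => [->|_]; last by rewrite mulr0 mul0r.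
  by rewrite (affine_tangent_tableauS Hp Tw) mulr0.
have not_comp : ~ component (ideal_square M (apolar_ideal part42 p)) part42 (xS pi).
  move=> [_ [z [Iz zE _]]]; have := ideal_square_tableauS HM Hp Iz.
  by rewrite zE xE coltensZ ffunE eqxx mulr1 => /eqP; rewrite (negPf a0).
by split=> // h; apply/not_comp/h.
Qed.
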